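(* Let $1\le n\le N$ be integers and let $T_{n,N}$ be the number of trials needed to open all $n$ locks with the totally random strategy. Then $$E(T_{n,N})=\frac{n(2N-n+1)}{2}\quad\text{and}\quad \mathrm{Var}(T_{n,N})=\frac{n(3N^2-3Nn+n^2-1)}{3}.$$ In particular, when $N=n$, $$E(T_{n,n})=\frac{n(n+1)}{2}\quad\text{and}\quad \mathrm{Var}(T_{n,n})=\frac{n(n-1)(n+1)}{3}.$$
   Context: There are $n$ locks and a keyring with $N\ge n$ keys. Each lock is opened by exactly one key of the keyring, distinct locks are opened by distinct keys, and no key opens more than one lock; the $N-n$ other keys open no lock. A trial consists of trying one key in one lock; successful trials are counted. Once a key has opened a lock, both the key and the lock are discarded; the remaining keys and remaining locks are those not discarded. Totally random strategy: at each trial, independently of all previous trials (no memory of past trials is kept except for the discarded locks and keys), choose one of the remaining keys uniformly at random and, independently, one of the remaining locks uniformly at random, and try this key in this lock. The process stops when all $n$ locks have been opened. *)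

(* Defs.v *)
From mathcomp Require Import all_boot all_order all_algebra.
Set Implicit Arguments.
Unset Strict Implicit.
Unset Printing Implicit Defensive.

(* Keys are the elements of 'I_N and locks the elements of 'I_n;
   [opens k l] means that key k opens lock l. *)
Definition keyring (n N : nat) (opens : 'I_N -> 'I_n -> bool) : Prop :=
  (forall l, exists! k, opens k l) /\
  (forall k l l', opens k l -> opens k l' -> l = l').

Definition trial (n N : nat) : Type := ('I_N * 'I_n)%type.

Definition discard (n N : nat) (opens : 'I_N -> 'I_n -> bool)
    (s : {set 'I_N} * {set 'I_n}) (x : trial n N) :
    {set 'I_N} * {set 'I_n} :=
  if opens x.1 x.2 then (s.1 :\ x.1, s.2 :\ x.2) else s.

(* Remaining keys and remaining locks after the trials of h, listed in
   chronological order. *)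
Definition remaining (n N : nat) (opens : 'I_N -> 'I_n -> bool)
    (h : seq (trial n N)) : {set 'I_N} * {set 'I_n} :=
  foldl (discard opens) ([set: 'I_N], [set: 'I_n]) h.

Definition remaining_keys (n N : nat) (opens : 'I_N -> 'I_n -> bool)
    (h : seq (trial n N)) : {set 'I_N} := (remaining opens h).1.

Definition remaining_locks (n N : nat) (opens : 'I_N -> 'I_n -> bool)
    (h : seq (trial n N)) : {set 'I_n} := (remaining opens h).2.

Definition all_opened (n N : nat) (opens : 'I_N -> 'I_n -> bool)
    (h : seq (trial n N)) : bool := remaining_locks opens h == set0.

Definition uniform_pmf (R : fieldType) (I : finType) (A : {set I}) (i : I) : R :=
  ((i \in A)%:R / #|A|%:R)%R.

From mathcomp Require Import all_classical all_reals all_analysis.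
Import Order.TTheory GRing.Theory Num.Theory.
Local Open Scope classical_set_scope.
Local Open Scope ring_scope.

(* The first t trials X 0, ..., X t.-1. *)
Definition history (n N : nat) (Omega : Type) (X : nat -> Omega -> trial n N)
    (t : nat) (w : Omega) : seq (trial n N) := mkseq (fun i => X i w) t.

(* Given any past h of the process that has not yet stopped, the key and the
   lock of the next trial are independent and uniform on the remaining keys and
   the remaining locks. The product form avoids conditioning on null events.
   Nothing is required of the variables X t after the process has stopped. *)
Definition totally_random (n N : nat) (opens : 'I_N -> 'I_n -> bool)
    (d : measure_display) (Omega : measurableType d) (R : realType)
    (P : probability Omega R) (X : nat -> Omega -> trial n N) : Prop :=
  (forall t x, measurable [set w | X t w = x]) /\
  (forall (h : seq (trial n N)), ~~ all_opened opens h ->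
   forall (k : 'I_N) (l : 'I_n),
   P [set w | history X (size h) w = h /\ X (size h) w = (k, l)] =
   (P [set w | history X (size h) w = h] *
    (uniform_pmf R (remaining_keys opens h) k *
     uniform_pmf R (remaining_locks opens h) l)%:E)%E).

(* +oo when some lock is never opened. *)
Definition num_trials (n N : nat) (opens : 'I_N -> 'I_n -> bool)
    (Omega : Type) (R : realType) (X : nat -> Omega -> trial n N)
    (w : Omega) : \bar R :=
  ereal_inf [set t%:R%:E | t in [set t : nat | all_opened opens (history X t w)]].

(* Main.v *)
(* While j locks are closed, their j keys are among the remaining N - n + j
   keys, so each trial succeeds with probability 1 / (N - n + j), whatever the
   past. The expected time to open j locks, g j, and its second moment, g2 j,
   are thus potentials: with J t the number of locks closed after t trials,
     E (g (J t)) - E (g (J t.+1)) = P (T > t), and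
     E (g2 (J t) + 2 t g (J t)) - E (g2 (J t.+1) + 2 t.+1 g (J t.+1))
       = (2 t + 1) P (T > t).
   Both sums telescope; bounded partial sums force the general terms, which
   dominate the remainders, to tend to 0. Hence E T = \sum_t P (T > t) = g n and
   E (T ^ 2) = \sum_t (2 t + 1) P (T > t) = g2 n, with no need to decompose T
   into independent geometric waiting times. *)

Require Import Defs.
From mathcomp Require Import all_boot all_order all_algebra.
From mathcomp Require Import all_classical all_reals all_analysis.
From mathcomp Require Import measurable_realfun ring.
Set Implicit Arguments.
Unset Strict Implicit.
Unset Printing Implicit Defensive.
Import Order.TTheory GRing.Theory Num.Theory numFieldNormedType.Exports.
Local Open Scope classical_set_scope.
Local Open Scope ring_scope.

(** * Remaining keys and locks, and the effect of one trial *)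

Section Strategy.
Context (n N : nat) (opens : 'I_N -> 'I_n -> bool).
Hypotheses (hnN : (n <= N)%N) (hopens : keyring opens).

Local Notation keys := (remaining_keys opens).
Local Notation locks := (remaining_locks opens).

Lemma remaining_rcons h x :
  remaining opens (rcons h x) = discard opens (remaining opens h) x.
Proof. by rewrite /remaining -cats1 foldl_cat. Qed.

(** A key and its lock are discarded together: by the two uniqueness clauses of [keyring], matching
    pairs share their key iff they share their lock. *)
Lemma mem_remaining h k l : opens k l -> (k \in keys h) = (l \in locks h).
Proof.
have [uniq_key uniq_lock] := hopens.
move=> okl; elim/last_ind: h => [|h [k' l'] IH]; first by rewrite !inE.
rewrite /remaining_keys /remaining_locks remaining_rcons /discard /=.
case: ifP => //= okl'; rewrite !inE; congr (~~ _ && _); last exact: IH.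
apply/eqP/eqP => e; move: okl'; rewrite -e => okl'.
  exact: uniq_lock okl okl'.
by have [k0 [_ u]] := uniq_key l; rewrite -(u _ okl) -(u _ okl').
Qed.

(** A successful trial discards one key and one lock or, if these are already gone, nothing; the
    surplus [N - n] is thus invariant. *)
Lemma card_remaining_keys h : #|keys h| = (#|locks h| + (N - n))%N.
Proof.
elim/last_ind: h => [|h [k l] IH].
  by rewrite /remaining_keys /remaining_locks /= !cardsT !card_ord subnKC.
rewrite /remaining_keys /remaining_locks remaining_rcons /discard /=.
case: ifP => //= okl; have := IH.
rewrite (cardsD1 k (keys h)) (cardsD1 l (locks h)) (mem_remaining h okl) -addnA.
by move/addnI.
Qed.

Lemma card_remaining_locks h : (#|locks h| <= n)%N.
Proof. by rewrite -[leqRHS]card_ord max_card. Qed.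

Lemma card_locks_rcons h x : x.2 \in locks h ->
  #|locks (rcons h x)| =
  if opens x.1 x.2 then #|locks h|.-1 else #|locks h|.
Proof.
move=> lL; rewrite /remaining_locks remaining_rcons /discard.
by case: ifP => //= _; rewrite (cardsD1 x.2 (remaining opens h).2) lL.
Qed.

Lemma all_opened_rcons h x : all_opened opens h -> all_opened opens (rcons h x).
Proof.
rewrite /all_opened /remaining_locks remaining_rcons /discard.
by case: ifP => //= _ /eqP ->; rewrite finset.set0D.
Qed.

Lemma sum_uniform_pmf (R : numFieldType) (I : finType) (A : {set I}) :
  A != finset.set0 -> \sum_i uniform_pmf R A i = 1.
Proof.
rewrite -card_gt0 => A0; rewrite /uniform_pmf -mulr_suml -natr_sum.
have -> : (\sum_i (i \in A))%N = #|A|.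
  by rewrite -sum1_card [RHS]big_mkcond; apply: eq_bigr => i _; case: (i \in A).
by rewrite divff // pnatr_eq0 -lt0n.
Qed.

(** The count drops by one with probability [1 / #|keys h|]: whichever remaining lock is drawn,
    exactly one remaining key opens it. *)
Lemma expected_step (R : numFieldType) h (f : nat -> R) :
  ~~ all_opened opens h ->
  \sum_x uniform_pmf R (keys h) x.1 * uniform_pmf R (locks h) x.2 *
      f #|locks (rcons h x)| =
  f #|locks h| + (f #|locks h|.-1 - f #|locks h|) / #|keys h|%:R.
Proof.
move=> nh.
have K0 : keys h != finset.set0.
  rewrite -card_gt0 card_remaining_keys addn_gt0; apply/orP; left.
  by rewrite card_gt0.
set j := #|locks h|; set c := f j.-1 - f j.
set K := keys h; set L := locks h.
(* Isolate the increment [c] caused by a success. Pairs outside [K] and [L] have weight zero. *)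
transitivity (\sum_k \sum_l (uniform_pmf R K k * uniform_pmf R L l * f j +
    uniform_pmf R L l * (uniform_pmf R K k * (opens k l)%:R) * c)).
  rewrite pair_bigA /=; apply: eq_bigr => -[k l] _ /=.
  have [kK|kK] := boolP (k \in K); last first.
    by rewrite /uniform_pmf (negbTE kK) !mul0r mulr0 mul0r addr0.
  have [lL|lL] := boolP (l \in L); last first.
    by rewrite /uniform_pmf (negbTE lL) !mul0r mulr0 !mul0r addr0.
  rewrite card_locks_rcons //=; rewrite /c -/j; case: ifP => _ /=; last first.
    by rewrite mulr0 mulr0 mul0r addr0.
  by rewrite mulr1 [_ L l * _]mulrC -mulrDr addrC subrK.
under eq_bigr do rewrite big_split /=.
rewrite big_split /=; congr (_ + _).
  under eq_bigr do rewrite -mulr_suml -mulr_sumr (sum_uniform_pmf R nh) mulr1.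
  by rewrite -mulr_suml sum_uniform_pmf // mul1r.
rewrite exchange_big /=.
under eq_bigr do rewrite -mulr_suml -mulr_sumr.
rewrite -mulr_suml mulrC; congr (_ * _).
rewrite -[RHS]mul1r -[X in _ = X * _](sum_uniform_pmf R nh) mulr_suml.
apply: eq_bigr => l _.
have [lL|lL] := boolP (l \in L); last first.
  by rewrite /uniform_pmf (negbTE lL) !mul0r.
(* Given [l], only its key [k0] contributes, and [k0] remains because [l] does. *)
congr (_ * _); have [k0 [okl u]] := hopens.1 l.
rewrite (bigD1 k0) //= big1 => [|k kk0].
  by rewrite okl mulr1n mulr1 addr0 /uniform_pmf (mem_remaining h okl) lL mul1r.
have [ok|_] := boolP (opens k l); last by rewrite mulr0.
by rewrite (u _ ok) eqxx in kk0.
Qed.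

End Strategy.

(** * Finite sums over the extensions of a history *)

Fixpoint sum_ext (A : finType) (V : nmodType) (t : nat) (F : seq A -> V)
    (h : seq A) : V :=
  if t is t'.+1 then \sum_x sum_ext t' F (rcons h x) else F h.

(** The definition peels off the first added trial; a one-step recursion in time needs the last
    one. *)
Lemma sum_extS (A : finType) (V : nmodType) t (F : seq A -> V) h :
  sum_ext t.+1 F h = sum_ext t (fun h => \sum_x F (rcons h x)) h.
Proof.
elim: t h => [//|t IH] h.
by rewrite [RHS]/=; apply: eq_bigr => x _; rewrite -IH.
Qed.

Lemma eq_sum_ext (A : finType) (V : nmodType) t (F G : seq A -> V) h :
  F =1 G -> sum_ext t F h = sum_ext t G h.
Proof. by move=> FG; elim: t h => //= t IH h; apply: eq_bigr => x _. Qed.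

Lemma sum_ext_linear (A : finType) (V : pzRingType) t (a : V)
    (F G : seq A -> V) h :
  sum_ext t (fun h => a * F h + G h) h = a * sum_ext t F h + sum_ext t G h.
Proof.
elim: t h => //= t IH h; rewrite mulr_sumr -big_split.
by apply: eq_bigr => x _ /=.
Qed.

Lemma le_sum_ext (A : finType) (V : numDomainType) t (F G : seq A -> V) h :
  (forall h, F h <= G h) -> sum_ext t F h <= sum_ext t G h.
Proof. by move=> FG; elim: t h => //= t IH h; apply: ler_sum. Qed.

(** * Law of the history and of the number of closed locks *)

Section Process.
Context (n N : nat) (opens : 'I_N -> 'I_n -> bool).
Hypotheses (hnN : (n <= N)%N) (hopens : keyring opens).
Context (R : realType) (d : measure_display) (Omega : measurableType d).
Context (P : probability Omega R) (X : nat -> Omega -> trial n N).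
Hypothesis hX : totally_random opens P X.

Local Notation keys := (remaining_keys opens).
Local Notation locks := (remaining_locks opens).

Lemma historyS t w : history X t.+1 w = rcons (history X t w) (X t w).
Proof. exact: mkseqS. Qed.

Lemma measurable_history t (Q : set (seq (trial n N))) :
  measurable [set w | Q (history X t w)].
Proof.
elim: t Q => [|t IH] Q.
  have [q|q] := pselect (Q [::]).
    by rewrite [X in measurable X](_ : _ = setT) //; apply/seteqP; split.
  by rewrite [X in measurable X](_ : _ = set0) //; apply/seteqP; split.
rewrite [X in measurable X](_ : _ = \bigcup_(x in [set: trial n N])
  ([set w | X t w = x] `&` [set w | Q (rcons (history X t w) x)])).
  apply: fin_bigcup_measurable; first exact: finite_finset.
  move=> x _; apply: measurableI; first exact: hX.1.
  exact: (IH (fun h => Q (rcons h x))).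
apply/seteqP; split => w /=.
  by rewrite historyS => ?; exists (X t w).
by move=> [x _ [<-]] /=; rewrite historyS.
Qed.

Lemma probability_split t (A : set Omega) : measurable A ->
  P A = (\sum_x P (A `&` [set w | X t w = x]))%E.
Proof.
move=> mA.
have {1}-> : A = \bigcup_(x in [set: trial n N]) (A `&` [set w | X t w = x]).
  apply/seteqP; split => w /=; last by case=> x _ [].
  by move=> Aw; exists (X t w).
rewrite measure_fin_bigcup //=.
- rewrite (fsbig_seq _ _ (index_enum_uniq _)).
  by apply: eq_fsbigl; apply/seteqP; split => x _ /=; rewrite ?mem_index_enum.
- by move=> x y _ _ [w [[_ <-] [_ <-]]].
- by move=> x _; apply: measurableI => //; exact: hX.1.
Qed.

Lemma fin_num_history t (Q : set (seq (trial n N))) :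
  P [set w | Q (history X t w)] \is a fin_num.
Proof. exact/fin_num_measure/measurable_history. Qed.

Definition hist_prob (h : seq (trial n N)) : R :=
  fine (P [set w | history X (size h) w = h]).

Lemma hist_prob_nil : hist_prob [::] = 1.
Proof.
rewrite /hist_prob [X in P X](_ : _ = setT) ?probability_setT //.
by apply/seteqP; split.
Qed.

Lemma hist_prob_ge0 h : 0 <= hist_prob h.
Proof. exact: fine_ge0. Qed.

Lemma history_rcons h x w : history X (size (rcons h x)) w = rcons h x <->
  history X (size h) w = h /\ X (size h) w = x.
Proof.
rewrite size_rcons historyS; split => [/eqP|[-> ->] //].
by rewrite eqseq_rcons => /andP[/eqP ? /eqP ?].
Qed.

Lemma hist_prob_rcons h x : ~~ all_opened opens h ->
  hist_prob (rcons h x) =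
  hist_prob h * (uniform_pmf R (keys h) x.1 * uniform_pmf R (locks h) x.2).
Proof.
move=> nh; case: x => k l /=; rewrite /hist_prob.
rewrite [X in fine (P X) = _](_ : _ =
  [set w | history X (size h) w = h /\ X (size h) w = (k, l)]); last first.
  by apply/seteqP; split => w /= /history_rcons.
rewrite (hX.2 h nh) fineM //; exact: (fin_num_history _ [set h]).
Qed.

(** Splitting on each next trial in turn makes an event about the history a finite sum; the case of
    empty [h] gives the tail of the number of trials. *)
Lemma prob_history_ext t h (Q : pred (seq (trial n N))) :
  P [set w | Q (history X (size h + t) w) /\ history X (size h) w = h] =
  (sum_ext t (fun h => hist_prob h * (Q h)%:R) h)%:E.
Proof.
elim: t h => [|t IH] h.
  rewrite addn0 /=; have [q|q] := boolP (Q h).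
    rewrite mulr1 fineK; last exact: (fin_num_history _ [set h]).
    by congr (P _); apply/seteqP; split => w /= => [[]//|e]; rewrite e.
  rewrite mulr0; transitivity (P set0); last exact: measure0.
  congr (P _).
  by apply/seteqP; split => w //= [+ e]; rewrite e (negbTE q).
rewrite (probability_split (size h)); last first.
  apply: measurableI; first exact: (measurable_history _ [set` Q]).
  exact: (measurable_history _ [set h]).
rewrite /= -sumEFin; apply: eq_bigr => x _; rewrite -IH; congr (P _).
rewrite size_rcons addSnnS; apply/seteqP; split => w /=.
  by move=> [[q e] ex]; split=> //; rewrite historyS e ex.
move=> [q e].
by have /history_rcons[] : history X (size (rcons h x)) w = rcons h x
  by rewrite size_rcons.
Qed.

(* The expectation of [f j], where [j] is the number of locks still closed
   after [t] trials. *)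
Definition mean (t : nat) (f : nat -> R) : R :=
  sum_ext t (fun h => hist_prob h * f #|locks h|) [::].

Lemma mean0 f : mean 0 f = f n.
Proof.
by rewrite /mean /= hist_prob_nil mul1r /remaining_locks /= cardsT card_ord.
Qed.

Lemma eq_mean t f g : f =1 g -> mean t f = mean t g.
Proof. by move=> fg; apply: eq_sum_ext => h; rewrite fg. Qed.

Lemma mean_linear t a f g :
  mean t (fun j => a * f j + g j) = a * mean t f + mean t g.
Proof.
rewrite /mean -sum_ext_linear; apply: eq_sum_ext => h.
by rewrite mulrDr mulrCA.
Qed.

Lemma le_mean t f g : (forall j, (j <= n)%N -> f j <= g j) ->
  mean t f <= mean t g.
Proof.
move=> fg; apply: le_sum_ext => h; rewrite ler_wpM2l ?hist_prob_ge0 // fg //.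
exact: card_remaining_locks.
Qed.

(* When [j] locks remain closed, so do their [j] keys among [j + (N - n)],
   hence a trial succeeds with probability
   [j / (j * (j + (N - n))) = 1 / (j + (N - n))]. *)
Lemma meanS t (f : nat -> R) : f 0%N = 0 ->
  mean t.+1 f = mean t (fun j => f j + (f j.-1 - f j) / (j + (N - n))%:R).
Proof.
move=> f0; rewrite /mean sum_extS; apply: eq_sum_ext => h.
(* Once all locks are open the law of the next trial is unspecified, but the count stays 0 and
   [f 0 = 0] makes both sides vanish. *)
have [oh|nh] := boolP (all_opened opens h).
  have /eqP locks0 := oh; rewrite locks0 cards0 /= f0 subrr mul0r addr0 mulr0.
  rewrite big1 // => x _.
  have /eqP -> := all_opened_rcons x oh.
  by rewrite cards0 f0 mulr0.
rewrite -card_remaining_keys // -expected_step // mulr_sumr.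
by apply: eq_bigr => x _; rewrite hist_prob_rcons // -[LHS]mulrA.
Qed.

Lemma tail_mean t :
  P [set w | ~~ all_opened opens (history X t w)] =
  (mean t (fun j => (0 < j)%:R))%:E.
Proof.
rewrite /mean; under eq_sum_ext do rewrite card_gt0 -/(all_opened opens _).
rewrite -prob_history_ext; congr (P _); apply/seteqP; split => w //=.
by case.
Qed.

End Process.

(** * Telescoping series, potentials and tail sums *)

Lemma nneseries_telescope (R : realType) (c q v : nat -> R) (G C : R) :
  (forall t, 0 <= c t * q t) ->
  (forall t, \sum_(0 <= s < t) c s * q s = G - v t) ->
  (forall t, 0 <= v t <= C * (c t * q t)) ->
  (\sum_(0 <= t <oo) (c t * q t)%:E)%E = G%:E.
Proof.
move=> cq0 sumcq vb; pose u t := c t * q t.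
have seriesE : series u = fun t => G - v t by apply/funext => t; exact: sumcq.
(* The partial sums increase and, as [v] is nonnegative, stay below [G]. *)
have cvgu : cvgn (series u).
  apply: nondecreasing_is_cvgn.
    apply/nondecreasing_seqP => t.
    by rewrite /series /= big_nat_recr //= lerDl cq0.
  exists G => _ [t _ <-]; rewrite seriesE lerBlDr lerDl.
  by have /andP[] := vb t.
(* The terms of a convergent series tend to 0, and [v] is squeezed below [C] times them. *)
have v0 : v @ \oo --> (0 : R).
  apply: (@squeeze_cvgr _ _ _ _ (cst 0) (fun t => C * u t)).
  - exact: nearW vb.
  - exact: cvg_cst.
  - by rewrite -[X in _ --> X](mulr0 C); apply: cvgM;
      [exact: cvg_cst|exact: cvg_series_cvg_0].
have lim_series : limn (series u) = G.
  apply/cvg_lim => //; rewrite seriesE -[X in _ --> X]subr0.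
  by apply: cvgB => //; exact: cvg_cst.
rewrite -lim_series -EFin_lim //; congr (limn _).
by apply/funext => t; rewrite /= sumEFin.
Qed.

Section Moments.
Context (n N : nat) (opens : 'I_N -> 'I_n -> bool).
Hypotheses (hnN : (n <= N)%N) (hopens : keyring opens).
Context (R : realType) (d : measure_display) (Omega : measurableType d).
Context (P : probability Omega R) (X : nat -> Omega -> trial n N).
Hypothesis hX : totally_random opens P X.

Local Notation mean := (mean opens P X).
Local Notation m := ((N - n)%:R : R).

(* Mean and variance of a sum of independent geometric variables of parameters
   1 / (m + 1), ..., 1 / (m + j). *)
Definition time_mean (j : nat) : R := j%:R * (2 * m + j%:R + 1) / 2.
Definition time_var (j : nat) : R :=
  j%:R * (3 * m ^+ 2 + 3 * m * j%:R + j%:R ^+ 2 - 1) / 3.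
Definition time_moment2 (j : nat) : R := time_var j + time_mean j ^+ 2.

Definition tail (t : nat) : R := mean t (fun j => (0 < j)%:R).

Lemma time_mean0 : time_mean 0 = 0.
Proof. by rewrite /time_mean !mul0r. Qed.

Lemma time_moment2_0 : time_moment2 0 = 0.
Proof. by rewrite /time_moment2 /time_var time_mean0 !mul0r add0r expr0n. Qed.

Lemma time_mean_ge0 j : 0 <= time_mean j.
Proof.
by rewrite /time_mean divr_ge0 // mulr_ge0 // !addr_ge0 // mulr_ge0.
Qed.

Lemma time_moment2_ge0 j : 0 <= time_moment2 j.
Proof.
rewrite /time_moment2 addr_ge0 ?sqr_ge0 //.
case: j => [|j]; rewrite /time_var; first by rewrite !mul0r.
rewrite divr_ge0 // mulr_ge0 // -addrA addr_ge0 //.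
by rewrite subr_ge0 exprn_ege1 // ler1n.
Qed.

(** While a lock is closed, each trial uses up one unit of expected remaining time. The right side
    has the shape of [mean_linear]. *)
Lemma time_mean_step j : time_mean j + (time_mean j.-1 - time_mean j) /
  (j + (N - n))%:R = -1 * (0 < j)%:R + time_mean j.
Proof.
case: j => [|j]; rewrite /time_mean /=.
  by rewrite subrr !mul0r mulr0 !add0r.
have : (j.+1 + (N - n))%:R != 0 :> R by rewrite pnatr_eq0.
by rewrite natrD -natr1 => ?; field.
Qed.

(** Expanding the square of one plus the remaining time gives, for [0 < j], g2 = 1 + 2 E(g') +
    E(g2') with E(g') = g - 1, where primes mean after one trial; hence E(g2') = g2 - 2 g + 1. *)
Lemma time_moment2_step j : time_moment2 j +
  (time_moment2 j.-1 - time_moment2 j) / (j + (N - n))%:R =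
  (-2) * time_mean j + (1 * (0 < j)%:R + time_moment2 j).
Proof.
case: j => [|j]; rewrite /time_moment2 /time_var /time_mean /=.
  by rewrite subrr !mul0r !mulr0 !add0r addr0.
have : (j.+1 + (N - n))%:R != 0 :> R by rewrite pnatr_eq0.
by rewrite natrD -natr1 => ?; field.
Qed.

Lemma sum_tail t : \sum_(0 <= s < t) tail s = time_mean n - mean t time_mean.
Proof.
elim: t => [|t IH]; first by rewrite big_geq // mean0 subrr.
rewrite big_nat_recr //= IH (meanS hnN hopens hX) ?time_mean0 //.
rewrite (eq_mean _ _ _ _ time_mean_step) mean_linear -/(tail t).
by rewrite mulN1r opprD opprK addrA addrAC.
Qed.

(** The term [2 * t * time_mean] absorbs the drop of [2 * time_mean] in the second moment; what is
    left at each step is [(2 * t + 1) * tail t]. *)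
Lemma sum_weighted_tail t : \sum_(0 <= s < t) (2 * s + 1)%:R * tail s =
  time_moment2 n - (mean t time_moment2 + 2 * t%:R * mean t time_mean).
Proof.
elim: t => [|t IH].
  by rewrite big_geq // mean0 mulr0 mul0r addr0 subrr.
rewrite big_nat_recr //= IH.
rewrite !(meanS hnN hopens hX) ?time_mean0 ?time_moment2_0 //.
rewrite (eq_mean _ _ _ _ time_mean_step) (eq_mean _ _ _ _ time_moment2_step).
rewrite !mean_linear -/(tail t) natrD natrM -natr1.
by ring.
Qed.

Lemma tail_ge0 t : 0 <= tail t.
Proof.
rewrite -lee_fin -(tail_mean hX); exact: measure_ge0.
Qed.

(** On [0..n], a nonnegative [f] with [f 0 = 0] is at most the sum of its values times the indicator
    of [0 < j]. Any constant free of [t] serves the squeeze. *)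
Lemma mean_bounds (f : nat -> R) t : f 0%N = 0 -> (forall j, 0 <= f j) ->
  0 <= mean t f <= (\sum_(j < n.+1) f j) * tail t.
Proof.
move=> f0 f_ge0; have mean_cst0 : mean t (fun=> 0) = 0.
  transitivity (mean t (fun=> -1 * 0 + 0)); last first.
    by rewrite mean_linear mulN1r addNr.
  by apply: eq_mean => j; rewrite mulr0 addr0.
apply/andP; split.
  by rewrite -mean_cst0; apply: le_mean => j _.
have -> : (\sum_(j < n.+1) f j) * tail t =
    mean t (fun j => (\sum_(j < n.+1) f j) * (0 < j)%:R + 0).
  by rewrite mean_linear mean_cst0 addr0.
apply: le_mean => -[|j] jn; first by rewrite f0 mulr0 addr0.
rewrite mulr1 addr0 (bigD1 (Ordinal (jn : (j.+1 < n.+1)%N))) //= lerDl.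
exact: sumr_ge0.
Qed.

Lemma series_tail : (\sum_(0 <= t <oo) (1 * tail t)%:E)%E = (time_mean n)%:E.
Proof.
apply: (@nneseries_telescope _ _ _ (fun t => mean t time_mean)
  _ (\sum_(j < n.+1) time_mean j)) => t.
- by rewrite mul1r tail_ge0.
- by rewrite -sum_tail; apply: eq_bigr => s _; rewrite mul1r.
- rewrite mul1r; exact: mean_bounds time_mean0 time_mean_ge0.
Qed.

Lemma series_weighted_tail :
  (\sum_(0 <= t <oo) ((2 * t + 1)%:R * tail t)%:E)%E = (time_moment2 n)%:E.
Proof.
apply: (@nneseries_telescope _ _ _
  (fun t => mean t time_moment2 + 2 * t%:R * mean t time_mean)
  _ (\sum_(j < n.+1) time_moment2 j + \sum_(j < n.+1) time_mean j)) => t.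
- by rewrite mulr_ge0 ?tail_ge0.
- exact: sum_weighted_tail.
- have /andP[a1 b1] := mean_bounds t time_mean0 time_mean_ge0.
  have /andP[a2 b2] := mean_bounds t time_moment2_0 time_moment2_ge0.
  (* The weight [2 * t + 1] is at least 1, for the second-moment part, and at least [2 * t], for the
     mean part. *)
  rewrite addr_ge0 ?mulr_ge0 //= [leRHS]mulrDl lerD //.
    apply: le_trans b2 _; rewrite ler_wpM2l ?sumr_ge0 // => [j _|].
      exact: time_moment2_ge0.
    by rewrite ler_peMl ?tail_ge0 // ler1n addn1.
  rewrite mulrCA -natrM; apply: ler_pM; rewrite ?ler_nat ?leq_addr //.
Qed.

End Moments.

(** * The number of trials as a series of indicators, and its moments *)

Section Trials.
Context (n N : nat) (opens : 'I_N -> 'I_n -> bool).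
Hypotheses (hnN : (n <= N)%N) (hopens : keyring opens).
Context (R : realType) (d : measure_display) (Omega : measurableType d).
Context (P : probability Omega R) (X : nat -> Omega -> trial n N).
Hypothesis hX : totally_random opens P X.

Local Notation T := (num_trials opens R X).
Local Notation tail := (tail opens P X).

Lemma all_opened_history s t w : (s <= t)%N ->
  all_opened opens (history X s w) -> all_opened opens (history X t w).
Proof.
move=> /subnKC <-; elim: (t - s)%N => [|k IH] os; first by rewrite addn0.
by rewrite addnS historyS; apply: all_opened_rcons; exact: IH.
Qed.

Definition unfinished (t : nat) : set Omega :=
  [set w | ~~ all_opened opens (history X t w)].

Lemma measurable_unfinished t : measurable (unfinished t).
Proof. exact: (measurable_history hX t [set h | ~~ all_opened opens h]). Qed.

(** Weights 1 give [T] and weights [2 * t + 1] give its square, so one integration lemma covers both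
    moments. *)
Definition wtime (c : nat -> R) (w : Omega) : \bar R :=
  (\sum_(0 <= t <oo) (c t)%:E * (\1_(unfinished t) w)%:E)%E.

Variant num_trials_spec w : \bar R -> Prop :=
| NumTrialsFin m of (forall t, \1_(unfinished t) w = (t < m)%:R :> R) :
    num_trials_spec w m%:R%:E
| NumTrialsInfty of (forall t, \1_(unfinished t) w = 1 :> R) :
    num_trials_spec w +oo%E.

Lemma num_trialsP w : num_trials_spec w (T w).
Proof.
have [ex_o|no] := pselect (exists t, all_opened opens (history X t w)).
- case: (ex_minnP ex_o) => m om min_m.
  have -> : T w = m%:R%:E.
    apply/eqP; rewrite eq_le; apply/andP; split.
      by apply: ereal_inf_lbound; exists m.
    by apply/ereal_infP => _ [t ot <-]; rewrite lee_fin ler_nat min_m.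
  apply: NumTrialsFin => t; rewrite indicE; congr (nat_of_bool _)%:R.
  apply/idP/idP => [/set_mem /= not|tm].
    rewrite ltnNge; apply: contra not => mt; exact: all_opened_history mt om.
  by apply/mem_set => /=; apply/negP => /min_m; rewrite leqNgt tm.
- have -> : T w = +oo%E.
    rewrite /num_trials [X in ereal_inf X](_ : _ = set0) ?ereal_inf0 //.
    by apply/seteqP; split => // x [t ot _]; case: no; exists t.
  apply: NumTrialsInfty => t; rewrite indicE mem_set //=.
  by apply/negP => ot; apply: no; exists t.
Qed.

Lemma wtime_fin c w m : (forall t, \1_(unfinished t) w = (t < m)%:R :> R) ->
  (forall t, 0 <= c t) -> wtime c w = (\sum_(0 <= t < m) c t)%:E.
Proof.
move=> S c0; rewrite /wtime (nneseries_split 0 m) ?add0n; last first.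
  by move=> k _; rewrite -EFinM lee_fin mulr_ge0.
rewrite eseries0 ?adde0 => [|k mk _]; last by rewrite S ltnNge mk mule0.
rewrite -sumEFin; apply: eq_big_nat => t /andP[_ tm].
by rewrite S tm mule1.
Qed.

Lemma num_trials_wtime w : T w = wtime (fun=> 1) w.
Proof.
case: num_trialsP => [m S|S].
  by rewrite (wtime_fin S) // sumr_const_nat subn0.
(* All indicators equal 1 here, so a partial sum of Archimedean length exceeds [A]. *)
apply/esym/eqyP => A A0; apply: le_trans (nneseries_lim_ge (Num.bound A) _).
  under eq_bigr do rewrite S mule1.
  by rewrite sumEFin lee_fin sumr_const_nat subn0 ltW // archi_boundP // ltW.
by move=> k _ _; rewrite S mule1.
Qed.

Lemma sum_odd m : \sum_(0 <= t < m) (2 * t + 1)%:R = m%:R ^+ 2 :> R.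
Proof.
elim: m => [|m IH]; first by rewrite big_geq // expr0n.
by rewrite big_nat_recr //= IH natrD natrM -natr1; ring.
Qed.

(** The first [m] odd numbers sum to [m ^+ 2]. Finiteness is assumed because [fine] sends [+oo] to 0
    while the series diverges. *)
Lemma num_trials_sqr w : T w \is a fin_num ->
  (fine (T w) ^+ 2)%:E = wtime (fun t => (2 * t + 1)%:R) w.
Proof. by case: num_trialsP => // m S _; rewrite (wtime_fin S) // sum_odd. Qed.

Lemma wtime_ge0 c w : (forall t, 0 <= c t) -> (0 <= wtime c w)%E.
Proof.
by move=> c0; apply: nneseries_ge0 => t _ _; rewrite -EFinM lee_fin mulr_ge0.
Qed.

Lemma measurable_wtime_term (c : R) t :
  measurable_fun setT
    ((fun w => c%:E * (\1_(unfinished t) w)%:E)%E : Omega -> \bar R).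
Proof.
apply: measurable_funeM; apply/measurable_EFinP.
exact/measurable_indic/measurable_unfinished.
Qed.

Lemma measurable_wtime c : (forall t, 0 <= c t) ->
  measurable_fun setT (wtime c).
Proof.
move=> c0; apply: ge0_emeasurable_sum => [t w _ _|t _].
  by rewrite -EFinM lee_fin mulr_ge0.
exact: measurable_wtime_term.
Qed.

(** Nonnegative terms let sum and integral be exchanged, and each indicator integrates to a tail
    probability. *)
Lemma integral_wtime c : (forall t, 0 <= c t) ->
  (\int[P]_w wtime c w = \sum_(0 <= t <oo) (c t * tail t)%:E)%E.
Proof.
move=> c0; rewrite integral_nneseries //; last first.
- by move=> t w _; rewrite -EFinM lee_fin mulr_ge0.
- by move=> t; exact: measurable_wtime_term.
apply: eq_eseriesr => t _.
have mS := measurable_unfinished t.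
rewrite ge0_integralZl //; last first.
- by rewrite lee_fin.
- exact/measurable_EFinP/measurable_indic.
by rewrite integral_indic // setIT EFinM; congr (_ * _)%E; exact: tail_mean.
Qed.

Lemma integral_num_trials : (\int[P]_w T w = (time_mean n N R n)%:E)%E.
Proof.
under eq_integral do rewrite num_trials_wtime.
by rewrite integral_wtime // (series_tail hnN hopens hX).
Qed.

Lemma measurable_num_trials : measurable_fun setT T.
Proof.
rewrite (_ : T = wtime (fun=> 1)); last exact/funext/num_trials_wtime.
exact: measurable_wtime.
Qed.

Lemma num_trials_ge0 w : (0 <= T w)%E.
Proof. by rewrite num_trials_wtime wtime_ge0. Qed.

(** A nonnegative function of finite integral is finite almost everywhere; [T] and [fine \o T] then
    have the same integral. *)
Lemma ae_num_trials_fin : {ae P, forall w, T w \is a fin_num}.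
Proof.
have iT : P.-integrable setT T.
  apply/integrableP; split; first exact: measurable_num_trials.
  under eq_integral do rewrite gee0_abs ?num_trials_ge0 //.
  by rewrite integral_num_trials ltry.
have := integrable_ae measurableT iT.
by apply: filterS => w; exact.
Qed.

Lemma measurable_fine_num_trials : measurable_fun setT (fine \o T).
Proof.
exact: measurableT_comp (fine_measurable measurableT) measurable_num_trials.
Qed.

Lemma expectation_num_trials : 'E_P[fine \o T]%E = (time_mean n N R n)%:E.
Proof.
rewrite unlock -integral_num_trials; apply: ge0_ae_eq_integral => //.
- exact/measurable_EFinP/measurable_fine_num_trials.
- exact: measurable_num_trials.
- by move=> w _; rewrite lee_fin fine_ge0 // num_trials_ge0.
- by move=> w _; exact: num_trials_ge0.
- by apply: filterS ae_num_trials_fin => w Tfin _ /=; rewrite fineK.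
Qed.

Lemma expectation_num_trials_sqr :
  'E_P[(fine \o T) * (fine \o T)]%E = (time_moment2 n N R n)%:E.
Proof.
rewrite unlock -(series_weighted_tail hnN hopens hX) -integral_wtime //.
have mT := measurable_fine_num_trials.
apply: ge0_ae_eq_integral => //.
- exact/measurable_EFinP/measurable_funM.
- exact: measurable_wtime.
- by move=> w _; rewrite lee_fin -expr2 sqr_ge0.
- by move=> w _; exact: wtime_ge0.
- by apply: filterS ae_num_trials_fin => w Tfin _ /=; rewrite -num_trials_sqr.
Qed.

Lemma variance_num_trials : 'V_P[fine \o T]%E = (time_var n N R n)%:E.
Proof.
have mT := measurable_fine_num_trials.
(* The formula E(T^2) - E(T)^2 requires [T] and its square to be integrable; both are nonnegative
   with a finite expectation. *)
have Lfun1 (f : Omega -> R) (r : R) : measurable_fun setT f ->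
    (forall w, 0 <= f w) -> 'E_P[f]%E = r%:E -> f \in Lfun P 1.
  move=> mf f0 Ef; apply/Lfun1_integrable/integrableP; split.
    exact/measurable_EFinP.
  under eq_integral do rewrite /= ger0_norm //.
  by move: Ef; rewrite unlock => ->; rewrite ltry.
have LT : fine \o T \in Lfun P 1.
  apply: Lfun1 expectation_num_trials => // w.
  by rewrite fine_ge0 // num_trials_ge0.
have LT2 : (fine \o T) * (fine \o T) \in Lfun P 1.
  apply: Lfun1 expectation_num_trials_sqr; first exact: measurable_funM.
  by move=> w; rewrite -[leRHS]expr2 sqr_ge0.
rewrite /variance covarianceE // expectation_num_trials_sqr.
by rewrite expectation_num_trials -EFinM -EFinB /time_moment2 expr2 addrK.
Qed.

End Trials.

(** * The closed formulas in [n] and [N] *)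

Theorem mainTheorem2 (n N : nat) (hn : (1 <= n)%N) (hnN : (n <= N)%N)
    (opens : 'I_N -> 'I_n -> bool) (hopens : keyring opens)
    (R : realType) (d : measure_display) (Omega : measurableType d)
    (P : probability Omega R) (X : nat -> Omega -> trial n N)
    (hX : totally_random opens P X) :
  let T : Omega -> \bar R := num_trials opens R X in
  [/\ {ae P, forall w, T w \is a fin_num},
      'E_P[fine \o T]%E =
        ((n%:R * (2 * N%:R - n%:R + 1)) / 2)%:E,
      'V_P[fine \o T]%E =
        ((n%:R * (3 * N%:R ^+ 2 - 3 * N%:R * n%:R + n%:R ^+ 2 - 1)) / 3)%:E
    & N = n ->
      'E_P[fine \o T]%E = ((n%:R * (n%:R + 1)) / 2)%:E /\
      'V_P[fine \o T]%E = ((n%:R * (n%:R - 1) * (n%:R + 1)) / 3)%:E ].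
Proof.
move=> T.
have ET := expectation_num_trials hnN hopens hX.
have VT := variance_num_trials hnN hopens hX.
(* The potentials are written in the surplus [N - n]; [n <= N] turns this truncated difference into
   a real one. *)
have mE : (N - n)%:R = N%:R - n%:R :> R by rewrite natrB.
split; first exact: (ae_num_trials_fin hnN hopens hX).
- by rewrite ET /time_mean mE; congr (_%:E); field.
- by rewrite VT /time_var mE; congr (_%:E); field.
- move=> Nn; have {}mE : (N - n)%:R = 0 :> R by rewrite Nn subnn.
  by rewrite ET VT /time_mean /time_var mE; split; congr (_%:E); field.
Qed.
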